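(* Let $E\subseteq\mathbb{R}$ be a compact set and let $d,D$ be real numbers with $0<d<\dim_L E\le\dim_A E<D<\infty$. Then there is a finite, positive Borel measure $\mu$ with support equal to $E$ such that $\dim_L\mu=d$ and $\dim_A\mu=D$.
   Context: For a compact set $E$ in a metric space and $F\subseteq E$, $N_r(F)$ denotes the least number of sets of diameter at most $r$ required to cover $F$; $B(x,R)$ is the open ball with centre $x$ and radius $R$. The upper and lower Assouad dimensions of $E$ are $$\dim_A E=\inf\Big\{\alpha:(\exists C_1,C_2>0)(\forall\,0<r<R<C_1)\ \sup_{x\in E}N_r(B(x,R)\cap E)\le C_2\Big(\frac Rr\Big)^{\alpha}\Big\},$$ $$\dim_L E=\sup\Big\{\alpha:(\exists C_1,C_2>0)(\forall\,0<r<R<C_1)\ \inf_{x\in E}N_r(B(x,R)\cap E)\ge C_2\Big(\frac Rr\Big)^{\alpha}\Big\}.$$ The upper and lower Assouad dimensions of a finite, positive Borel measure $\mu$ with support $\operatorname{supp}\mu$ are $$\dim_A\mu=\inf\Big\{\alpha:(\exists C_1,C_2>0)(\forall\,0<r\le R\le C_1)\ \sup_{x\in\operatorname{supp}\mu}\frac{\mu(B(x,R))}{\mu(B(x,r))}\le C_2\Big(\frac Rr\Big)^{\alpha}\Big\},$$ $$\dim_L\mu=\sup\Big\{\alpha:(\exists C_1,C_2>0)(\forall\,0<r<R<C_1)\ \inf_{x\in\operatorname{supp}\mu}\frac{\mu(B(x,R))}{\mu(B(x,r))}\ge C_2\Big(\frac Rr\Big)^{\alpha}\Big\}.$$ *)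

(* Defs.v *)
From HB Require Import structures.
From mathcomp Require Import all_boot all_order all_algebra.
From mathcomp Require Import all_classical all_reals all_analysis.

Set Implicit Arguments.
Unset Strict Implicit.
Unset Printing Implicit Defensive.

Import Order.TTheory GRing.Theory Num.Theory.
Import numFieldNormedType.Exports.

Local Open Scope classical_set_scope.
Local Open Scope ring_scope.

Definition diam (R : realType) (T : metricType R) (A : set T) : \bar R :=
  ereal_sup [set (mdist p.1 p.2)%:E | p in A `*` A].

(* N_r(F); the infimum is attained as soon as F has a finite cover of this
   kind, and the value is +oo otherwise. *)
Definition covering_number (R : realType) (T : metricType R)
    (r : R) (F : set T) : \bar R :=
  ereal_inf [set n%:R%:E | n in [set n : nat | exists A : 'I_n -> set T,
    (forall i, (diam (A i) <= r%:E)%E) /\ F `<=` \bigcup_i A i]].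

(* In the four dimensions below r < s are the two radii (R being the field of
   reals). The exponents range over all real numbers and the dimensions are
   extended reals, with inf set0 = +oo and sup set0 = -oo. *)
Definition upper_assouad (R : realType) (T : metricType R) (E : set T)
    : \bar R :=
  ereal_inf [set a%:E | a in [set a : R |
    exists C1 C2 : R, [/\ 0 < C1, 0 < C2 &
      forall r s : R, 0 < r -> r < s -> s < C1 ->
        (ereal_sup [set covering_number r (ball x s `&` E) | x in E]
           <= (C2 * (s / r) `^ a)%:E)%E]]].

Definition lower_assouad (R : realType) (T : metricType R) (E : set T)
    : \bar R :=
  ereal_sup [set a%:E | a in [set a : R |
    exists C1 C2 : R, [/\ 0 < C1, 0 < C2 &
      forall r s : R, 0 < r -> r < s -> s < C1 ->
        (ereal_inf [set covering_number r (ball x s `&` E) | x in E]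
           >= (C2 * (s / r) `^ a)%:E)%E]]].

Definition msupport (R : realType) (T : metricType R) (mu : set T -> \bar R)
    : set T :=
  [set x | forall U : set T, open U -> U x -> (0 < mu U)%E].

(* The quotients are taken in \bar R; for a finite measure and x in its support
   the denominator is finite and positive, so they are quotients of reals. *)
Definition upper_assouad_measure (R : realType) (T : metricType R)
    (mu : set T -> \bar R) : \bar R :=
  ereal_inf [set a%:E | a in [set a : R |
    exists C1 C2 : R, [/\ 0 < C1, 0 < C2 &
      forall r s : R, 0 < r -> r <= s -> s <= C1 ->
        (ereal_sup [set mu (ball x s) / mu (ball x r) | x in msupport mu]
           <= (C2 * (s / r) `^ a)%:E)%E]]].

Definition lower_assouad_measure (R : realType) (T : metricType R)
    (mu : set T -> \bar R) : \bar R :=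
  ereal_sup [set a%:E | a in [set a : R |
    exists C1 C2 : R, [/\ 0 < C1, 0 < C2 &
      forall r s : R, 0 < r -> r < s -> s < C1 ->
        (ereal_inf [set mu (ball x s) / mu (ball x r) | x in msupport mu]
           >= (C2 * (s / r) `^ a)%:E)%E]]].

(* Main.v *)
(** Fix a small ratio [lam] and maximal [rho0 * lam ^+ k]-separated subsets of [E],
    and let every point of level [k.+1] be a child of a nearest point of level [k].
    Mass is passed from parents to children in proportions between [p = lam `^ D] and
    [q = lam `^ d]; this is possible because [d < dim_L E] gives each point many
    children close to it and [dim_A E < D] bounds the number of all its children.
    The children away from their parent receive exactly [p].  If two nearby points
    have different parents, both are such boundary children, so that nearby points of
    a level have comparable masses and the mass of a ball is comparable to that of any
    cell of the same size that it meets.  Hence the mass ratio of concentric balls of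
    radii [r <= s] lies between constant multiples of [(s / r) `^ d] and
    [(s / r) `^ D].  Both exponents are attained because every point has a child of
    proportion exactly [p] and one of proportion exactly [q], and hence infinite rays
    along which the masses are [p ^+ k] and [q ^+ k].  The limit measure is the image
    of Lebesgue measure on an interval subdivided according to the masses. *)

Require Import Defs.
From HB Require Import structures.
From mathcomp Require Import all_boot all_order all_algebra.
From mathcomp Require Import all_classical all_reals all_analysis.
From mathcomp Require Import measurable_realfun ring lra.

Set Implicit Arguments.
Unset Strict Implicit.
Unset Printing Implicit Defensive.

Import Order.TTheory GRing.Theory Num.Theory.
Import numFieldNormedType.Exports.

Local Open Scope classical_set_scope.
Local Open Scope ring_scope.

(** * Distribution of mass among children *)

Section Offsets.
Context (R : realType).
Implicit Types (m : R -> R) (s : seq R).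

(** Left end point of the block of [y] when blocks of lengths [m] are laid end to end from 0 in the
    order of [s]. *)
Fixpoint offset m s (y : R) : R :=
  if s is x :: s' then if x == y then 0 else m x + offset m s' y else 0.

Lemma offset_ge0 m s y : (forall x, x \in s -> 0 <= m x) -> 0 <= offset m s y.
Proof.
elim: s => [//|x s IH] /= mge0; case: eqP => // _.
apply: addr_ge0; first by rewrite mge0 ?mem_head.
by apply: IH => z zs; rewrite mge0 // inE zs orbT.
Qed.

Lemma offset_le_sum m s y : (forall x, x \in s -> 0 <= m x) -> y \in s ->
  offset m s y + m y <= \sum_(x <- s) m x.
Proof.
elim: s => [//|x s IH] /= mge0.
have mge0' z : z \in s -> 0 <= m z by move=> zs; rewrite mge0 // inE zs orbT.
rewrite inE eq_sym big_cons; case: eqP => [<- _|_ /= ys].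
  by rewrite add0r lerDl; rewrite big_seq sumr_ge0 // => z zs; exact: mge0'.
by rewrite -addrA lerD2l; exact: IH.
Qed.

Lemma offset_exists m s u : uniq s -> (forall x, x \in s -> 0 <= m x) ->
  0 <= u < \sum_(x <- s) m x ->
  exists2 y, y \in s & offset m s y <= u < offset m s y + m y.
Proof.
elim: s u => [|x s IH] u /=; first by rewrite big_nil; lra.
move=> /andP[xs us] mge0; rewrite big_cons => /andP[u0 uU].
have [um|mu] := ltP u (m x).
  by exists x; rewrite ?mem_head // eqxx add0r u0 um.
have [||y ys yu] := IH (u - m x) us.
- by move=> z zs; rewrite mge0 // inE zs orbT.
- by move: u0 uU mu; lra.
exists y; first by rewrite inE ys orbT.
have /negbTE -> : x != y by apply: contraNneq xs => ->.
by move: yu; lra.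
Qed.

Lemma offset_inj m s u y z : uniq s -> (forall x, x \in s -> 0 <= m x) ->
  y \in s -> z \in s ->
  offset m s y <= u < offset m s y + m y ->
  offset m s z <= u < offset m s z + m z -> y = z.
Proof.
elim: s u => [//|x s IH] u /= /andP[xs us] mge0.
have mge0' a : a \in s -> 0 <= m a by move=> zs; rewrite mge0 // inE zs orbT.
rewrite !inE ![_ == x]eq_sym.
case: eqP => [<- _|_ /= ys]; case: eqP => [<- _//|_ /= zs].
- by have := offset_ge0 z mge0'; lra.
- by have := offset_ge0 y mge0'; lra.
- move=> h1 h2; apply: (IH (u - m x)) => //; first by move: h1; lra.
  by move: h2; lra.
Qed.

End Offsets.

Section Weights.
Context (R : realType).

(* Every child receives [p]; one core child is topped up to [q], another one
   receives nothing more, and the remaining mass is shared equally by the other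
   core children. *)
Lemma weights_exist (S : seq R) (core : pred R) (p q : R) :
  uniq S -> 0 < p -> q <= 2^-1 ->
  (size S)%:R * p <= 2^-1 -> 2 <= (count core S)%:R * q ->
  exists w : R -> R, [/\ \sum_(y <- S) w y = 1,
    forall y, y \in S -> p <= w y <= q,
    forall y, y \in S -> ~~ core y -> w y = p,
    exists2 y, y \in S & w y = q &
    exists2 y, y \in S & w y = p].
Proof.
move=> uS p0 q2 nS cS.
have cnS : (count core S)%:R <= (size S)%:R :> R by rewrite ler_nat count_size.
have cp : (count core S)%:R * p <= 2^-1 by rewrite (le_trans _ nS)// ler_pM2r.
have : size [seq x <- S | core x] = count core S by rewrite size_filter.
have : perm_eq S ([seq x <- S | core x] ++ [seq x <- S | predC core x]).
  by rewrite perm_sym perm_filterC.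
have cT : all core [seq x <- S | core x] by exact: filter_all.
(* [a] will receive [q] and [b] exactly [p]. Fewer than two core children are impossible, because
   their number times [q] is at least 2 while [q <= 2^-1]. *)
case: [seq x <- S | core x] cT => [|a [|b T]] cT pS cE.
- by move: cS; rewrite -cE /=; lra.
- by move: cS; rewrite -cE /=; lra.
have cE' : (count core S)%:R = 2 + (size T)%:R :> R.
  by rewrite -cE /= -natr1 -natr1; lra.
have T0 : 0 < (size T)%:R :> R.
  have c0 : 0 <= (count core S)%:R :> R by [].
  suff : 4 <= (count core S)%:R :> R by lra.
  by nra.
have q0 : p < q.
  rewrite ltNge; apply/negP => qp.
  have := ler_wpM2l (ler0n R (count core S)) qp; lra.
set n := (size S)%:R : R.
(* The share of each element of [T] in what remains after giving [p] to every child and topping up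
   [a]. With [c] core children, [e <= q - p] amounts to [1 - n * p <= (c - 1) * (q - p)], whose
   right side is at least [2 - 1/2 - 1/2 + p]. *)
pose e := (1 - n * p - (q - p)) / (size T)%:R.
have e0 : 0 <= e by rewrite divr_ge0 ?ler0n // /n; lra.
have eq : e <= q - p.
  rewrite ler_pdivrMr//; move: cE' cS cp nS; rewrite -/n => cE' cS cp nS.
  have -> : (size T)%:R = (count core S)%:R - 2 :> R by rewrite cE'; ring.
  by nra.
pose x y := if y == a then q - p else if y \in T then e else 0.
have uS' : uniq ((a :: b :: T) ++ [seq x <- S | predC core x]) by rewrite -(perm_uniq pS).
have memS y : (y \in S) = (y \in (a :: b :: T) ++ [seq x <- S | predC core x]).
  by rewrite (perm_mem pS).
have [/= aN bN] : [/\ a \notin b :: T ++ [seq x <- S | predC core x]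
    & b \notin T ++ [seq x <- S | predC core x]].
  by move: uS' => /= /andP[-> /andP[-> _]].
exists (fun y => p + x y); split.
- rewrite big_split /= big_const_seq count_predT iter_addr addr0.
  rewrite (perm_big _ pS) /= !big_cons big_cat /=.
  have -> : x a = q - p by rewrite /x eqxx.
  have -> : x b = 0.
    rewrite /x; case: eqP => [ba|_]; first by move: aN; rewrite ba mem_head.
    by move: bN; rewrite mem_cat => /norP[/negbTE ->].
  rewrite (eq_big_seq (fun=> e)); last first.
    move=> y yT; rewrite /x yT; case: eqP => // ya.
    by move: aN; rewrite -ya inE mem_cat yT orbT.
  rewrite big_const_seq count_predT iter_addr addr0.
  rewrite [X in _ *+ size T + X]big1_seq ?addr0; last first.
    move=> y /andP[_ yF]; rewrite /x; case: eqP => [ya|_].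
      by move: aN; rewrite -ya inE mem_cat yF !orbT.
    case: ifP => // yT; move: yF; rewrite mem_filter /= => /andP[/negP[]].
    by move/allP: cT; apply; rewrite !inE yT !orbT.
  rewrite -[p *+ _]mulr_natl -[e *+ _]mulr_natl /e -/n.
  by field; rewrite gt_eqF.
- move=> y _; rewrite /x; case: eqP => _; first by lra.
  by case: ifP => _; lra.
- move=> y yS yc; rewrite /x.
  have /negP yabT : y \notin a :: b :: T.
    by apply: contra yc; exact: (allP cT).
  case: eqP => [ya|_]; first by case: yabT; rewrite ya mem_head.
  by case: ifP => [yT|_]; [case: yabT; rewrite !inE yT !orbT|rewrite addr0].
- by exists a; [rewrite memS mem_head|rewrite /x eqxx; ring].
- exists b; first by rewrite memS !inE eqxx orbT.
  rewrite /x; case: eqP => [ba|_]; first by move: aN; rewrite ba mem_head.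
  by move: bN; rewrite mem_cat => /norP[/negbTE ->]; rewrite addr0.
Qed.

End Weights.

(** * Separated nets and covering numbers *)

Section Nets.
Context (R : realType).
Implicit Types (E F : set R^o) (s : seq R).

Definition separated (delta : R) s :=
  forall x y, x \in s -> y \in s -> x != y -> delta <= `|x - y|.

(** Each of the [L] consecutive half-open slots of length [delta] starting at [a] contains at most
    one point of [s]. *)
Lemma separated_size s (a delta : R) (L : nat) :
  0 < delta -> uniq s -> separated delta s ->
  (forall x, x \in s -> a <= x < a + L%:R * delta) -> (size s <= L)%N.
Proof.
move=> d0 us sep sa.
pose f (x : R) := Num.truncn ((x - a) / delta).
have fx x : x \in s -> (f x)%:R * delta <= x - a < (f x).+1%:R * delta.
  move=> /sa xs; have : 0 <= (x - a) / delta by rewrite divr_ge0 ?(ltW d0)//; lra.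
  by move=> /truncn_itv; rewrite ler_pdivlMr // ltr_pdivrMr.
have uf : uniq (map f s).
  rewrite map_inj_in_uniq// => x y xs ys fxy.
  apply/eqP; apply: contraT => xy.
  have := sep _ _ xs ys xy; have := fx _ xs; have := fx _ ys.
  rewrite fxy -natr1 => /andP[y1 y2] /andP[x1 x2].
  by rewrite leNgt ltr_norml; move/negP; case; apply/andP; split; lra.
rewrite -(size_map f) -(size_iota 0 L); apply: uniq_leq_size => // n /mapP[x xs ->].
rewrite mem_iota add0n /= -(ltr_nat R) -(ltr_pM2r d0).
by have := fx _ xs; have := sa _ xs; lra.
Qed.

(** A separated list of maximal length works: lengths are bounded because [E] is, and an uncovered
    point of [E] could be added to the list. *)
Lemma net_exists E (delta : R) : compact E -> 0 < delta ->
  exists s, [/\ uniq s, forall y, y \in s -> E y, separated delta s &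
    forall x, E x -> exists2 y, y \in s & `|x - y| < delta].
Proof.
move=> /compact_bounded[M [_ /(_ (Num.max (M + 1) 1))]].
have -> : M < Num.max (M + 1) 1 by rewrite lt_max ltrDl ltr01.
move=> /(_ isT); set B := Num.max _ _ => EB d0.
have B0 : 0 < B by rewrite lt_max ltr01 orbT.
pose L := (Num.truncn (2 * B / delta)).+2.
have LB : 2 * B + delta < L%:R * delta.
  have : 0 <= 2 * B / delta by rewrite divr_ge0 ?(ltW d0)//; lra.
  move=> /truncn_itv/andP[_]; rewrite ltr_pdivrMr // /L -[X in _ < X * _]natr1; lra.
pose ok s := [/\ uniq s, forall y, y \in s -> E y & separated delta s].
have okL s : ok s -> (size s <= L)%N.
  move=> [us sE sep]; apply: (@separated_size s (- B) delta) => // x /sE/EB.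
  rewrite /= ler_norml; lra.
pose P n := `[< exists s, ok s /\ size s = n >].
have P0 : exists n, P n by exists 0%N; apply/asboolP; exists [::].
have PL n : P n -> (n <= L)%N by move=> /asboolP[s [/okL + <-]].
case: (ex_maxnP P0 PL) => n /asboolP[s [[us sE sep] sn]] nmax.
exists s; split=> // x Ex; apply: contrapT => nex.
have xs y : y \in s -> delta <= `|x - y|.
  by move=> ys; rewrite leNgt; apply/negP => xy; apply: nex; exists y.
suff /nmax : P (size s).+1 by rewrite sn ltnn.
apply/asboolP; exists (x :: s); split => //; split => /=.
- rewrite us andbT; apply/negP => /xs; rewrite subrr normr0; lra.
- by move=> y; rewrite inE => /orP[/eqP->//|/sE].
- move=> y z; rewrite !inE => /orP[/eqP->|ys] /orP[/eqP->|zs].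
  + by rewrite eqxx.
  + by move=> _; exact: xs.
  + by move=> _; rewrite distrC; exact: xs.
  + exact: sep.
Qed.

(** A set of diameter at most [r] contains at most one point of [s], so sending each point to a set
    that covers it is injective. *)
Lemma le_covering_number (r : R) F s : uniq s -> (forall x, x \in s -> F x) ->
  (forall x y, x \in s -> y \in s -> x != y -> r < `|x - y|) ->
  ((size s)%:R%:E <= covering_number r F)%E.
Proof.
move=> us sF sep; apply: le_ereal_inf_tmp => _ [n [A [dA FA]] <-].
rewrite lee_fin ler_nat.
have [->|s0] := eqVneq (size s) 0%N; first by [].
have : forall x, exists i, x \in s -> A i x.
  (* Outside [s] any index serves; there is one, since [n = 0] would leave the points of the
     nonempty [s] uncovered. *)
  move=> x; case: (boolP (x \in s)) => xs; last first.
    case: n A dA FA => [|n] A dA FA; last by exists ord0.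
    by case: s us sF sep s0 xs => // y s _ /(_ y) + _ _; rewrite mem_head => /(_ isT)/FA[[]].
  by have [i _ Aix] := FA _ (sF _ xs); exists i.
move=> /choice[f fA].
have uf : uniq (map f s).
  rewrite map_inj_in_uniq// => x y xs ys fxy.
  apply/eqP; apply: contraT => xy; have := sep _ _ xs ys xy.
  rewrite ltNge => /negP[]; rewrite distrC -lee_fin; apply: le_trans (dA (f x)).
  apply: ereal_sup_ubound; exists (x, y) => //=; split; first exact: fA.
  by rewrite /= fxy; exact: fA.
by rewrite -(size_map f) -(card_uniqP uf) -[X in (_ <= X)%N]card_ord max_card.
Qed.

Lemma covering_number_le (r : R) F s :
  (forall x, F x -> exists2 y, y \in s & `|x - y| <= r / 2) ->
  (covering_number r F <= (size s)%:R%:E)%E.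
Proof.
move=> Fs; apply: ereal_inf_lbound; exists (size s) => //.
exists (fun i => [set x : R^o | `|x - nth 0 s i| <= r / 2]); split.
  move=> i; apply: ge_ereal_sup => _ [[x y] /= [xi yi] <-].
  rewrite lee_fin (_ : mdist x y = `|y - x|) //.
  by move: xi yi; rewrite ler_norml => ?; rewrite ler_norml => ?; rewrite ler_norml; lra.
move=> x /Fs[y ys xy]; exists (Ordinal (introT idP (etrans (index_mem y s) ys))) => //=.
by rewrite nth_index.
Qed.

End Nets.

(** * Limits of sequences with geometrically small steps *)

Section GeometricSequences.
Context (R : realType).

(** The intervals of radius [2 * rho k] about [y k] are nested, as
    [rho k + 2 * rho k.+1 <= 2 * rho k]. The limit is taken along their left end points, which form
    a bounded monotone sequence. *)
Lemma geometric_cvg (y rho : nat -> R) :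
  (forall k, rho k.+1 <= rho k / 2) -> (forall k, 0 <= rho k) ->
  (forall k, `|y k.+1 - y k| <= rho k) ->
  exists l, (fun k => y k - 2 * rho k) @ \oo --> l /\
    forall k, `|l - y k| <= 2 * rho k.
Proof.
move=> rho2 rho0 yrho; pose b k := y k - 2 * rho k.
have bnd : nondecreasing_seq b.
  apply/nondecreasing_seqP => k; rewrite /b; have := yrho k; have := rho2 k.
  by rewrite ler_norml; lra.
pose c k := y k + 2 * rho k.
have cnd : nonincreasing_seq c.
  apply/nonincreasing_seqP => k; rewrite /c; have := yrho k; have := rho2 k.
  by rewrite ler_norml; lra.
have bc i j : b i <= c j.
  apply: (@le_trans _ _ (b (maxn i j))); first by apply: bnd; rewrite leq_maxl.
  apply: (@le_trans _ _ (c (maxn i j))); last by apply: cnd; rewrite leq_maxr.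
  by rewrite /b /c; have := rho0 (maxn i j); lra.
have cvb : cvgn b.
  by apply: nondecreasing_is_cvgn => //; exists (c 0) => _ [k _ <-]; exact: bc.
exists (limn b); split => // k; rewrite ler_norml; apply/andP; split.
  by have := nondecreasing_cvgn_le bnd cvb k; rewrite /b; lra.
have : limn b <= c k by apply: limr_le => //; apply: nearW => i; exact: bc.
by rewrite /c; lra.
Qed.

Lemma exists_expr_lt (lam c e : R) : 0 <= lam < 1 -> 0 < c -> 0 < e ->
  exists k, c * lam ^+ k < e.
Proof.
move=> /andP[l0 l1] c0 e0.
have : (fun n => lam ^+ n) @ \oo --> (0 : R) by apply: cvg_expr; rewrite ger0_norm.
move=> /cvgrPdist_lt/(_ (e / c) (divr_gt0 e0 c0))[k _ /(_ k (leqnn k))] /=.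
rewrite sub0r normrN ger0_norm ?exprn_ge0// ltr_pdivlMr// mulrC => ?.
by exists k.
Qed.

Lemma compact_adherent (E : set R^o) (l : R) : compact E ->
  (forall e, 0 < e -> exists2 y, E y & `|l - y| < e) -> E l.
Proof.
move=> cE lE; have : closed E by apply: compact_closed => //; exact: Rhausdorff.
move=> /(_ l); apply => U /nbhs_ballP[e /= e0 eU].
by have [y Ey ly] := lE _ e0; exists y; split => //; apply: eU; rewrite -ball_normE.
Qed.

End GeometricSequences.

(** * Trees of nets *)

(* A net tree consists of [rho k]-nets of [E], [rho k = rho0 * lam ^+ k], in which
   every point of level [k.+1] is a child of a nearby point of level [k] and carries
   the proportion [weight k y] of the mass of its parent. *)
Record net_tree (R : realType) (E : set R^o) (rho0 lam p q : R) := NetTree {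
  net : nat -> seq R;
  parent : nat -> R -> R;
  weight : nat -> R -> R;
  net_uniq : forall k, uniq (net k);
  net_sub : forall k y, y \in net k -> E y;
  net_sep : forall k, separated (rho0 * lam ^+ k) (net k);
  net_cover : forall k x, E x ->
    exists2 y, y \in net k & `|x - y| < rho0 * lam ^+ k;
  parent_net : forall k y, y \in net k.+1 -> parent k y \in net k;
  parent_dist : forall k y, y \in net k.+1 ->
    `|y - parent k y| < rho0 * lam ^+ k;
  parent_near : forall k x y, y \in net k.+1 -> x \in net k ->
    `|y - x| < rho0 * lam ^+ k / 2 -> parent k y = x;
  weight_sum : forall k x, x \in net k ->
    \sum_(y <- [seq y <- net k.+1 | parent k y == x]) weight k y = 1;
  weight_itv : forall k y, y \in net k.+1 -> p <= weight k y <= q;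
  weight_boundary : forall k y, y \in net k.+1 ->
    rho0 * lam ^+ k / 4 < `|y - parent k y| -> weight k y = p;
  heavy_child : forall k x, x \in net k ->
    exists2 y, y \in net k.+1 & parent k y = x /\ weight k y = q;
  light_child : forall k x, x \in net k ->
    exists2 y, y \in net k.+1 & parent k y = x /\ weight k y = p
}.

Section TreeMass.
Context (R : realType) (E : set R^o) (rho0 lam p q : R).
Context (rho0_gt0 : 0 < rho0) (lam_gt0 : 0 < lam) (lam_small : lam <= 64^-1).
Context (p_gt0 : 0 < p) (pq : p <= q) (q_small : q <= 2^-1).
Variable t : net_tree E rho0 lam p q.
Implicit Types (k n : nat) (u x y z : R).

Notation rho k := (rho0 * lam ^+ k).

Lemma rho_gt0 k : 0 < rho k.
Proof. by rewrite mulr_gt0 ?exprn_gt0. Qed.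

Lemma rhoS k : rho k.+1 = lam * rho k.
Proof. by rewrite exprS mulrCA. Qed.

Lemma rhoS_le k : rho k.+1 <= rho k / 64.
Proof. by rewrite rhoS mulrC; apply: ler_wpM2l; rewrite ?(ltW (rho_gt0 k)). Qed.

Fixpoint mass k (y : R) : R :=
  if k is k'.+1 then mass k' (parent t k' y) * weight t k' y else 1.

Lemma mass_gt0 k y : y \in net t k -> 0 < mass k y.
Proof.
elim: k y => [|k IH] y yk //=; rewrite mulr_gt0 ?IH ?parent_net //.
by have /andP[+ _] := weight_itv yk; exact: lt_le_trans.
Qed.

Lemma mass_parent k y : y \in net t k.+1 ->
  p * mass k (parent t k y) <= mass k.+1 y <= q * mass k (parent t k y).
Proof.
move=> yk /=; have /ltW m0 := mass_gt0 (parent_net yk).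
by rewrite ![_ * mass _ _]mulrC !ler_wpM2l//; have /andP[] := weight_itv yk.
Qed.

Definition children k x := [seq y <- net t k.+1 | parent t k y == x].

Lemma mem_children k x y :
  (y \in children k x) = (parent t k y == x) && (y \in net t k.+1).
Proof. by rewrite mem_filter. Qed.

Lemma sum_mass_children k x : x \in net t k ->
  \sum_(y <- children k x) mass k.+1 y = mass k x.
Proof.
move=> xk; rewrite (eq_big_seq (fun y => mass k x * weight t k y)).
  by rewrite -big_distrr /= weight_sum // mulr1.
by move=> y; rewrite mem_children => /andP[/eqP <- _].
Qed.

(* If the parents of [y] and [z] differ, both are boundary children and receive the
   same proportion [p] of the mass of their parents, so the bound is inherited. *)
Lemma mass_near n y z : y \in net t n -> z \in net t n ->
  `|y - z| <= 10 * rho n -> p * mass n y <= mass n z.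
Proof.
elim: n y z => [|n IH] y z yn zn yz; first by rewrite /= mulr1; move: pq q_small; lra.
have [yz_par|yz_par] := eqVneq (parent t n y) (parent t n z).
  have /andP[+ _] := mass_parent zn; apply: le_trans.
  rewrite ler_wpM2l ?(ltW p_gt0)// -yz_par.
  have /andP[_ +] := mass_parent yn; move/le_trans; apply.
  by have := mass_gt0 (parent_net yn); move: q_small; nra.
have r0 := rho_gt0 n; have rS := rhoS_le n.
(* If [a] were within [rho n / 4] of its parent, then [b] would be within
   [(1/4 + 10/64) * rho n < rho n / 2] of it, and [parent_near] would give both the same parent. *)
have boundary a b : a \in net t n.+1 -> b \in net t n.+1 ->
    `|a - b| <= 10 * rho n.+1 -> parent t n a != parent t n b ->
    weight t n a = p.
  move=> an bn ab ab_par; apply: weight_boundary => //.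
  rewrite ltNge; apply: contra ab_par => a_par; apply/eqP/esym.
  apply: parent_near => //; first exact: parent_net.
  move: ab a_par; rewrite !ler_norml ltr_norml; lra.
rewrite /= (boundary y z) // (boundary z y) //; last first.
- by rewrite eq_sym.
- by rewrite distrC.
rewrite mulrA ler_pM2r//; apply: IH; rewrite ?parent_net//.
(* The parents are less than [(2 + 10/64) * rho n] apart, so the constant 10 is good for the coarser
   level too. *)
have := parent_dist yn; have := parent_dist zn; move: yz.
by rewrite !ltr_norml !ler_norml; lra.
Qed.

(** The ancestor at level [k] of a point [y] of level [n]; for [k >= n] the value is [y]. *)
Fixpoint branch n y k : R :=
  if n is n'.+1 then
    if (k <= n')%N then branch n' (parent t n' y) k else y
  else y.

Lemma branch_last n y : branch n y n = y.
Proof. by case: n => [//|n] /=; rewrite ltnn. Qed.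

Lemma branch_net n y k : (k <= n)%N -> y \in net t n -> branch n y k \in net t k.
Proof.
elim: n y => [|n IH] y /=; first by rewrite leqn0 => /eqP->.
move=> kn yn; case: ifPn => [kn'|]; first by apply: IH => //; exact: parent_net.
by rewrite -ltnNge => nk; have -> : k = n.+1 by apply/eqP; rewrite eqn_leq kn.
Qed.

Lemma branch_parent n y k : (k < n)%N -> y \in net t n ->
  parent t k (branch n y k.+1) = branch n y k.
Proof.
elim: n y => [//|n IH] y /=; rewrite ltnS => kn yn; rewrite kn.
case: ifPn => [kn'|]; first by apply: IH => //; exact: parent_net.
rewrite -leqNgt => nk; have -> : k = n by apply/eqP; rewrite eqn_leq kn.
by rewrite branch_last.
Qed.

(** The steps to successive ancestors are summed geometrically. The term [- 2 * rho n] closes the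
    induction and leaves room for replacing [y] by a point of [E] close to it. *)
Lemma branch_dist n y k : (k <= n)%N -> y \in net t n ->
  `|y - branch n y k| <= 2 * rho k - 2 * rho n.
Proof.
elim: n y => [|n IH] y /=; first by rewrite leqn0 => /eqP -> _; rewrite subrr normr0; lra.
move=> kn yn; case: ifPn => [kn'|]; last first.
  by rewrite -ltnNge subrr normr0 => nk; have -> : k = n.+1; [apply/eqP; rewrite eqn_leq kn|lra].
have := IH _ kn' (parent_net yn); have := parent_dist yn.
have := rhoS_le n; have := rho_gt0 n.
by rewrite !ler_norml !ltr_norml; lra.
Qed.

Lemma mass_branch n y m : (m <= n)%N -> y \in net t n ->
  p ^+ (n - m) * mass m (branch n y m) <= mass n y
    <= q ^+ (n - m) * mass m (branch n y m).
Proof.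
elim: n y => [|n IH] y mn yn.
  by move: mn; rewrite leqn0 => /eqP ->; rewrite subnn !expr0 !mul1r lexx.
move: mn; rewrite leq_eqVlt => /orP[/eqP ->|mn].
  by rewrite subnn !expr0 !mul1r branch_last lexx.
have /andP[IH1 IH2] := IH _ mn (parent_net yn).
have /andP[m1 m2] := mass_parent yn.
rewrite subSn// !exprS -!mulrA; move: mn; rewrite ltnS => mn.
rewrite [branch _ _ _]/= mn; apply/andP; split.
  by apply: le_trans m1; rewrite ler_pM2l.
by apply: (le_trans m2); rewrite ler_pM2l// (lt_le_trans p_gt0).
Qed.

End TreeMass.

(** * The limit measure *)

Section TreeCells.
Context (R : realType) (E : set R^o) (rho0 lam p q : R).
Context (rho0_gt0 : 0 < rho0) (lam_gt0 : 0 < lam) (lam_small : lam <= 64^-1).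
Context (p_gt0 : 0 < p) (pq : p <= q) (q_small : q <= 2^-1).
Variable t : net_tree E rho0 lam p q.
Implicit Types (k n : nat) (u x y z : R).

Notation rho k := (rho0 * lam ^+ k).
Notation m := (mass t).

Let mass_ge0 k y : y \in net t k -> 0 <= m k y.
Proof. by move=> yk; exact/ltW/mass_gt0. Qed.

(* The points of level [k] are laid out as consecutive intervals of length [mass k],
   those of level [k.+1] subdividing the ones of level [k]. *)
Fixpoint start k y : R :=
  if k is k'.+1 then
    start k' (parent t k' y) + offset (m k) (children t k' (parent t k' y)) y
  else offset (m 0) (net t 0) y.

Definition in_cell k y u := start k y <= u < start k y + m k y.

Definition total_mass : R := (size (net t 0))%:R.

Let sum_mass0 : \sum_(y <- net t 0) m 0 y = total_mass.
Proof. by rewrite /= big_const_seq count_predT iter_addr addr0. Qed.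

Let children_mass_ge0 k x y : y \in children t k x -> 0 <= m k.+1 y.
Proof. by rewrite mem_children => /andP[_ yk]; exact: mass_ge0. Qed.

Let children_uniq k x : uniq (children t k x).
Proof. by rewrite filter_uniq// net_uniq. Qed.

Lemma in_cell_parent k y u : y \in net t k.+1 ->
  in_cell k.+1 y u -> in_cell k (parent t k y) u.
Proof.
move=> yk; set x := parent t k y => /andP[]; rewrite [start _ _]/= -/x => u1 u2.
have xk : x \in net t k by exact: parent_net.
have yx : y \in children t k x by rewrite mem_children eqxx.
have := offset_ge0 y (@children_mass_ge0 k x).
have := offset_le_sum (@children_mass_ge0 k x) yx.
by rewrite sum_mass_children// /in_cell; lra.
Qed.

Lemma in_cell_total k y u : y \in net t k -> in_cell k y u -> 0 <= u < total_mass.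
Proof.
elim: k y => [|k IH] y yk; last by move/in_cell_parent => /(_ yk); apply: IH; exact: parent_net.
have := offset_ge0 y (@mass_ge0 0); have := offset_le_sum (@mass_ge0 0) yk.
by rewrite sum_mass0 /in_cell /=; lra.
Qed.

(** By induction the parents agree, and the blocks of siblings are disjoint. *)
Lemma in_cell_inj k y z u : y \in net t k -> z \in net t k ->
  in_cell k y u -> in_cell k z u -> y = z.
Proof.
elim: k y z => [|k IH] y z yk zk yu zu.
  by apply: (offset_inj (net_uniq t 0) (@mass_ge0 0) yk zk yu zu).
have yz : parent t k y = parent t k z.
  by apply: IH; rewrite ?parent_net//; exact: in_cell_parent.
move: yu zu; rewrite /in_cell [start _ _]/= [start _ z]/= -yz => yu zu.
apply: (@offset_inj _ (m k.+1) (children t k (parent t k y))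
  (u - start k (parent t k y))) => //.
- exact: children_mass_ge0.
- by rewrite mem_children eqxx.
- by rewrite mem_children yz eqxx.
- by move: yu; lra.
- by move: zu; lra.
Qed.

Lemma in_cell_exists k u : 0 <= u < total_mass ->
  exists2 y, y \in net t k & in_cell k y u.
Proof.
elim: k => [|k IH] uM.
  by apply: offset_exists; [exact: net_uniq|exact: mass_ge0|rewrite sum_mass0].
have [x xk /andP[xu ux]] := IH uM.
have [||y] := @offset_exists _ (m k.+1) (children t k x) (u - start k x) (children_uniq k x).
- exact: children_mass_ge0.
- by rewrite sum_mass_children//; lra.
rewrite mem_children => /andP[/eqP yx yk] yu; exists y => //.
by rewrite /in_cell [start _ _]/= yx; lra.
Qed.

(** The net point of level [k] whose cell contains [u], and 0 outside [[0, total_mass)]. Writing it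
    as a finite combination of indicators of intervals makes its measurability evident. *)
Definition address k u : R :=
  \sum_(y <- net t k) y * \1_([set` `[start k y, start k y + m k y[] : set R) u.

Let indic_cell k y u :
  \1_([set` `[start k y, start k y + m k y[] : set R) u = (in_cell k y u)%:R :> R.
Proof. by rewrite indicE mem_setE in_itv. Qed.

Lemma addressE k y u : y \in net t k -> in_cell k y u -> address k u = y.
Proof.
move=> yk yu; rewrite /address (bigD1_seq y) ?net_uniq//= indic_cell yu mulr1.
rewrite big1_seq ?addr0// => z /andP[zy zk]; rewrite indic_cell.
case: (boolP (in_cell k z u)) => zu; last by rewrite mulr0.
by rewrite (in_cell_inj zk yk zu yu) eqxx in zy.
Qed.

Lemma address_out k u : ~~ (0 <= u < total_mass) -> address k u = 0.
Proof.
move=> uM; rewrite /address big1_seq// => z /andP[_ zk]; rewrite indic_cell.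
case: (boolP (in_cell k z u)) => zu; last by rewrite mulr0.
by rewrite (in_cell_total zk zu) in uM.
Qed.

Lemma address_dist k u : `|address k.+1 u - address k u| <= rho k.
Proof.
case: (boolP (0 <= u < total_mass)) => uM; last first.
  by rewrite !address_out// subrr normr0 ltW// rho_gt0.
have [y yk yu] := in_cell_exists k.+1 uM.
rewrite (addressE yk yu) (addressE (parent_net yk) (in_cell_parent yk yu)).
exact/ltW/parent_dist.
Qed.

Lemma measurable_address k :
  measurable_fun [set: measurableTypeR R] (address k : measurableTypeR R -> R).
Proof.
apply: measurable_sum => y; apply: measurable_funM; first exact: measurable_cst.
exact: measurable_indic.
Qed.

Let limit_exists u : exists l,
  (fun k => address k u - 2 * rho k) @ \oo --> l /\
  forall k, `|l - address k u| <= 2 * rho k.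
Proof.
apply: (@geometric_cvg _ (address^~ u) (fun k => rho k)) => k; last exact: address_dist.
- have := rho_gt0 rho0_gt0 lam_gt0 k; have := rhoS_le rho0_gt0 lam_gt0 lam_small k; lra.
- exact/ltW/rho_gt0.
Qed.

Definition limit_point u : R := sval (cid (limit_exists u)).

Lemma limit_point_dist k u : `|limit_point u - address k u| <= 2 * rho k.
Proof. by have [_ /(_ k)] := svalP (cid (limit_exists u)). Qed.

(** A pointwise limit of measurable functions, along the shifted sequence for which [geometric_cvg]
    provides convergence. *)
Lemma measurable_limit_point :
  measurable_fun [set: measurableTypeR R] (limit_point : measurableTypeR R -> R).
Proof.
apply: (@measurable_fun_cvg _ _ _ _
  (fun k (u : measurableTypeR R) => address k u - 2 * rho k)).
  by move=> k; apply: measurable_funB; [exact: measurable_address|exact: measurable_cst].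
by move=> u _; have [] := svalP (cid (limit_exists u)).
Qed.

End TreeCells.

(** * Images of finite measures *)

Section ImageMeasure.
Context d d' (T1 : measurableType d) (T2 : measurableType d') (R : realType).
Variables (nu : {finite_measure set T1 -> \bar R}) (g : T1 -> T2).
Hypothesis mg : measurable_fun [set: T1] g.

Let image := pushforward nu g.

Let measurable_preimage A : measurable A -> measurable (g @^-1` A).
Proof. by move=> mA; rewrite -[X in measurable X]setTI; exact: mg. Qed.

Let image0 : image set0 = 0%E.
Proof. by rewrite /image /pushforward preimage_set0 measure0. Qed.

Let image_ge0 A : (0 <= image A)%E.
Proof. exact: measure_ge0. Qed.

Let image_sigma_additive : semi_sigma_additive image.
Proof.
move=> F mF tF mUF; rewrite /image /pushforward preimage_bigcup.
apply: measure_semi_sigma_additive.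
- by move=> n; exact: measurable_preimage.
- apply/trivIsetP => i j _ _ ij; rewrite -preimage_setI.
  by move/trivIsetP: tF => ->//; rewrite preimage_set0.
- by rewrite -preimage_bigcup; exact: measurable_preimage.
Qed.

HB.instance Definition _ := isMeasure.Build _ _ _ image
  image0 image_ge0 image_sigma_additive.

Let image_fin : fin_num_fun image.
Proof. by move=> A mA; apply: fin_num_measure; exact: measurable_preimage. Qed.

HB.instance Definition _ := Measure_isFinite.Build _ _ _ image image_fin.

Lemma finite_image_measure :
  exists mu : {finite_measure set T2 -> \bar R}, forall A, mu A = nu (g @^-1` A).
Proof. by exists image. Qed.

End ImageMeasure.

(** Finite subadditivity over a list: split off the first set and apply the induction hypothesis to
    the part of [A] outside it. *)
Lemma measure_le_sum_seq d (T : measurableType d) (R : realFieldType) (I : eqType)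
    (mu : {measure set T -> \bar R}) (s : seq I) (F : I -> set T) (A : set T) :
  (forall i, measurable (F i)) -> measurable A ->
  (forall x, A x -> exists2 i, i \in s & F i x) ->
  (mu A <= \sum_(i <- s) mu (F i))%E.
Proof.
move=> mF; elim: s A => [|i s IH] A mA AF.
  rewrite big_nil; suff -> : A = set0 by rewrite measure0.
  by apply/seteqP; split => // x /AF[].
have mAF : measurable (A `\` F i) by exact: measurableD.
apply: (@le_trans _ _ (mu (F i `|` (A `\` F i)))).
  rewrite le_measure ?inE//; first exact: measurableU.
  by move=> x Ax; have [Fx|Fx] := pselect (F i x); [left|right].
rewrite big_cons (le_trans (measureU2 _ _ _))// leeD2l//.
apply: IH => // x [/AF[j]]; rewrite inE => /orP[/eqP -> //|js Fx _].
by exists j.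
Qed.

(** * Masses of balls under the limit measure *)

Section TreeMeasure.
Context (R : realType) (E : set R^o) (rho0 lam p q : R).
Context (rho0_gt0 : 0 < rho0) (lam_gt0 : 0 < lam) (lam_small : lam <= 64^-1).
Context (p_gt0 : 0 < p) (pq : p <= q) (q_small : q <= 2^-1).
Context (compact_E : compact E).
Variable t : net_tree E rho0 lam p q.
Implicit Types (k n : nat) (u x y z : R).

Notation rho k := (rho0 * lam ^+ k).
Notation m := (mass t).
Let limit := limit_point rho0_gt0 lam_gt0 lam_small p_gt0 t.
Let domain : set (measurableTypeR R) := [set` `[0, total_mass t[].

Let measurable_domain : measurable domain.
Proof. exact: measurable_itv. Qed.

Let domain_finite : (lebesgue_measure domain < +oo)%E.
Proof. by rewrite lebesgue_measure_itv /=; case: ifP => _; rewrite ltry. Qed.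

Let cell n z : set (measurableTypeR R) := [set` `[start t n z, start t n z + m n z[].

Let in_cellE n z u : cell n z u = in_cell t n z u.
Proof. by rewrite /cell /= in_itv. Qed.

Let in_domainE u : domain u = (0 <= u < total_mass t).
Proof. by rewrite /domain /= in_itv. Qed.

Let cell_measure n z : z \in net t n -> lebesgue_measure (cell n z) = (m n z)%:E.
Proof.
move=> zn; have m0 := mass_gt0 p_gt0 zn.
rewrite lebesgue_measure_itv /= lte_fin ltrDl m0 -EFinD.
by congr (_%:E); ring.
Qed.

Let limit_dist n z u : z \in net t n -> cell n z u -> `|limit u - z| <= 2 * rho n.
Proof.
rewrite in_cellE => zn zu; rewrite -(addressE p_gt0 zn zu).
exact: limit_point_dist.
Qed.

(** For every [k] the limit is within [2 * rho k] of a net point, and [E] is closed. *)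
Let limit_E u : domain u -> E (limit u).
Proof.
rewrite in_domainE => uM; apply: compact_adherent => // e e0.
have [k ke] : exists k, (2 * rho0) * lam ^+ k < e.
  apply: exists_expr_lt => //; last by rewrite mulr_gt0.
  by rewrite (ltW lam_gt0) /=; move: lam_small; lra.
have [y yk yu] := in_cell_exists p_gt0 k uM.
exists y; first exact: net_sub yk.
by apply: le_lt_trans ke; rewrite -mulrA; apply: limit_dist; rewrite ?in_cellE.
Qed.



(** The measure is the image under [limit] of Lebesgue measure on [domain]. The cell of [z] is
    mapped to within [2 * rho n] of [z], hence to within [4 * rho n] of [x], which gives the lower
    estimate. *)
Lemma tree_measure_exists :
  exists mu : {finite_measure set (measurableTypeR R) -> \bar R}, [/\
    mu (~` E) = 0%E,
    forall n z x r, z \in net t n -> `|z - x| <= 2 * rho n -> 4 * rho n < r ->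
      ((m n z)%:E <= mu (ball (x : R^o) r))%E &
    forall n z x r, z \in net t n -> `|z - x| <= 2 * rho n -> r <= 6 * rho n ->
      (mu (ball (x : R^o) r) <= (17 / p * m n z)%:E)%E].
Proof.
have mlimit : measurable_fun [set: measurableTypeR R] (limit : _ -> measurableTypeR R).
  exact: measurable_limit_point.
have [mu muE] := finite_image_measure (mfrestr measurable_domain domain_finite) mlimit.
have {}muE A : mu A = lebesgue_measure ((limit @^-1` A) `&` domain) by rewrite muE.
have mball x r : measurable ((limit @^-1` (ball (x : R^o) r)) `&` domain).
  apply: measurableI => //; rewrite -[X in measurable X]setTI.
  by apply: mlimit => //; exact: measurable_ball.
exists mu; split.
- rewrite muE [X in lebesgue_measure X](_ : _ = set0) ?measure0//.
  by apply/seteqP; split => // u [/= nE /limit_E].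
- move=> n z x r zn zx rn; rewrite -(cell_measure zn) muE.
  apply: le_measure; rewrite ?inE; [exact: measurable_itv|exact: mball|].
  move=> u zu; split; last first.
    by rewrite in_domainE; move: zu; rewrite in_cellE; exact: in_cell_total.
  rewrite -ball_normE /=; have := limit_dist zn zu; move: zx.
  by rewrite !ler_norml ltr_norml; lra.
- move=> n z x r zn zx rn.
  (* Only the cells of these points can meet the preimage of the ball, as [8 = 6 + 2]. There is at
     most one point in each of the 17 slots of length [rho n] starting at [x - 8 * rho n], and all
     are within [(8 + 2) * rho n] of [z], the range of [mass_near]. *)
  pose s := [seq y <- net t n | `|y - x| <= 8 * rho n].
  have r0 := rho_gt0 rho0_gt0 lam_gt0 n.
  have s17 : (size s <= 17)%N.
    apply: (@separated_size _ _ (x - 8 * rho n) (rho n)) => //.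
    + by rewrite filter_uniq// net_uniq.
    + move=> a b; rewrite !mem_filter => /andP[_ an] /andP[_ bn].
      exact: (@net_sep _ _ _ _ _ _ t n).
    + by move=> a; rewrite mem_filter ler_norml; lra.
  rewrite muE; apply: (@le_trans _ _ (\sum_(y <- s) lebesgue_measure (cell n y))%E).
    apply: measure_le_sum_seq; [by move=> y; exact: measurable_itv|exact: mball|].
    move=> u []; rewrite -ball_normE in_domainE /= => ux uM.
    have [y yn yu] := in_cell_exists p_gt0 n uM; rewrite -in_cellE in yu.
    exists y => //; rewrite mem_filter yn andbT.
    have := limit_dist yn yu; move: ux.
    by rewrite !ler_norml ltr_norml; lra.
  apply: (@le_trans _ _ (\sum_(y <- s) (p^-1 * m n z)%:E)%E).
    rewrite big_seq [leRHS]big_seq; apply: lee_sum => y; rewrite mem_filter => /andP[yx yn].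
    rewrite cell_measure// lee_fin ler_pdivlMl//.
    apply: (mass_near rho0_gt0 lam_gt0 lam_small) => //.
    by move: yx zx; rewrite !ler_norml; lra.
  rewrite sumEFin lee_fin big_const_seq count_predT iter_addr addr0 -[leLHS]mulr_natl mulrA.
  rewrite ler_wpM2r//; first exact/ltW/mass_gt0.
  by rewrite ler_pM2r ?invr_gt0// ler_nat.
Qed.

End TreeMeasure.

(** * Mass ratios and Assouad dimensions *)

Section AssouadOfMeasure.
Context (R : realType).
Implicit Types (a b c C r s : R).

(** If [b < a], the power of [x] with exponent [a - b] would be bounded by [C / c] for [x > 1], yet
    it takes the value [B], that is 2 more than the absolute value of [C / c]. *)
Lemma powR_comparison_le a b c C : 0 < c ->
  (forall x, 1 < x -> c * x `^ a <= C * x `^ b) -> a <= b.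
Proof.
move=> c0 cC; rewrite leNgt; apply/negP => ab.
have e0 : 0 < a - b by lra.
pose B := `|C / c| + 2; have B0 : 0 < B by rewrite /B ltr_wpDl.
pose x := B `^ (a - b)^-1.
have x0 : 0 < x by exact: powR_gt0.
have xe : x `^ (a - b) = B by rewrite /x -powRrM mulVf ?gt_eqF// powRr1// ltW.
have x1 : 1 < x.
  rewrite ltNge; apply/negP => x1; have : x `^ (a - b) <= 1 `^ (a - b).
    by rewrite ge0_ler_powR ?nnegrE// ltW.
  by rewrite xe powR1 /B; have := normr_ge0 (C / c); lra.
have := cC _ x1; have -> : a = (a - b) + b by ring.
rewrite powRD; last by rewrite (gt_eqF x0) implybT.
rewrite xe mulrA ler_pM2r ?powR_gt0// mulrC -ler_pdivlMr//.
by have := ler_norm (C / c); rewrite /B; lra.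
Qed.

Variables (mu : set R^o -> \bar R) (E : set R^o) (F : R -> R -> R).
Hypothesis suppE : msupport mu = E.
Hypothesis muE : forall x r, E x -> 0 < r -> mu (ball (x : R^o) r) = (F x r)%:E.
Hypothesis F_gt0 : forall x r, E x -> 0 < r -> 0 < F x r.

Let ratioE x r s : E x -> 0 < r -> 0 < s ->
  (mu (ball (x : R^o) s) / mu (ball (x : R^o) r))%E = (F x s / F x r)%:E.
Proof. by move=> Ex r0 s0; rewrite !muE// inver gt_eqF ?F_gt0// EFinM. Qed.

(** The uniform bound makes [a] admissible. Conversely, the radii [s / x] and [s] at the single
    centre [x0] realise every ratio [x > 1], so [powR_comparison_le] puts each admissible exponent
    above [a]. *)
Lemma upper_assouad_measure_eq a s0 c C x0 : 0 < s0 -> 0 < c -> 0 < C -> E x0 ->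
  (forall x r s, E x -> 0 < r -> r <= s -> s <= s0 ->
    F x s <= C * (s / r) `^ a * F x r) ->
  (forall r s, 0 < r -> r <= s -> s <= s0 ->
    c * (s / r) `^ a * F x0 r <= F x0 s) ->
  upper_assouad_measure mu = a%:E.
Proof.
move=> s0_gt0 c0 C0 Ex0 Fle Fge; rewrite /upper_assouad_measure suppE.
apply/eqP; rewrite eq_le; apply/andP; split.
  apply: ereal_inf_lbound; exists a => //; exists s0, C; split=> // r s r0 rs ss0.
  apply: ge_ereal_sup => _ [x Ex <-]; have s_gt0 := lt_le_trans r0 rs.
  by rewrite ratioE// lee_fin ler_pdivrMr ?F_gt0//; exact: Fle.
apply: le_ereal_inf_tmp => _ [b [C1 [C2 [C1_gt0 C20 bC]]] <-]; rewrite lee_fin.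
apply: (powR_comparison_le (C := C2) c0) => x x1.
pose s := Num.min C1 s0.
have s_gt0 : 0 < s by rewrite lt_min C1_gt0.
have sC1 : s <= C1 by rewrite ge_min lexx.
have ss0 : s <= s0 by rewrite ge_min lexx orbT.
have x_gt0 : 0 < x by lra.
have r0 : 0 < s / x by rewrite divr_gt0.
have rs : s / x <= s by rewrite ler_pdivrMr// ler_peMr// ltW.
have xE : s / (s / x) = x by rewrite invf_div mulrCA mulfV ?gt_eqF// mulr1.
have := bC _ _ r0 rs sC1.
move=> /(le_trans (ereal_sup_ubound (imageP _ Ex0))).
rewrite ratioE// lee_fin xE; apply: le_trans.
by rewrite ler_pdivlMr ?F_gt0//; have := Fge _ _ r0 rs ss0; rewrite xE.
Qed.

Lemma lower_assouad_measure_eq a s0 c C x0 : 0 < s0 -> 0 < c -> 0 < C -> E x0 ->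
  (forall x r s, E x -> 0 < r -> r <= s -> s <= s0 ->
    c * (s / r) `^ a * F x r <= F x s) ->
  (forall r s, 0 < r -> r <= s -> s <= s0 ->
    F x0 s <= C * (s / r) `^ a * F x0 r) ->
  lower_assouad_measure mu = a%:E.
Proof.
move=> s0_gt0 c0 C0 Ex0 Fge Fle; rewrite /lower_assouad_measure suppE.
apply/eqP; rewrite eq_le; apply/andP; split; last first.
  apply: ereal_sup_ubound; exists a => //; exists s0, c; split=> // r s r0 rs ss0.
  apply: le_ereal_inf_tmp => _ [x Ex <-]; have s_gt0 := lt_trans r0 rs.
  by rewrite ratioE// lee_fin ler_pdivlMr ?F_gt0//; apply: Fge => //; exact: ltW.
apply: ge_ereal_sup => _ [b [C1 [C2 [C1_gt0 C20 bC]]] <-]; rewrite lee_fin.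
apply: (powR_comparison_le (C := C) C20) => x x1.
(* The half keeps [s] strictly below [C1], as the definition of the lower dimension demands; the
   upper one allows equality. *)
pose s := Num.min C1 s0 / 2.
have : 0 < Num.min C1 s0 by rewrite lt_min C1_gt0.
have : Num.min C1 s0 <= C1 by rewrite ge_min lexx.
have : Num.min C1 s0 <= s0 by rewrite ge_min lexx orbT.
move=> min1 min2 min0.
have s_gt0 : 0 < s by rewrite /s; lra.
have sC1 : s < C1 by rewrite /s; lra.
have ss0 : s <= s0 by rewrite /s; lra.
have x_gt0 : 0 < x by lra.
have r0 : 0 < s / x by rewrite divr_gt0.
have rs : s / x < s by rewrite ltr_pdivrMr// ltr_pMr.
have xE : s / (s / x) = x by rewrite invf_div mulrCA mulfV ?gt_eqF// mulr1.
have := bC _ _ r0 rs sC1.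
move=> /le_trans/(_ (ereal_inf_lbound (imageP _ Ex0))).
rewrite ratioE// lee_fin xE => /le_trans; apply.
by rewrite ler_pdivrMr ?F_gt0//; have := Fle _ _ r0 (ltW rs) ss0; rewrite xE.
Qed.

End AssouadOfMeasure.

(** * Comparison of radii with the scales of the tree *)

Section Scales.
Context (R : realType) (rho0 lam : R).
Context (rho0_gt0 : 0 < rho0) (lam_gt0 : 0 < lam) (lam_lt1 : lam < 1).
Implicit Types (r s : R) (n m : nat).

Notation rho k := (rho0 * lam ^+ k).

(** The factor 6 suits both ball estimates: the upper one holds at level [n] for [r <= 6 * rho n],
    and [r] exceeds the [4 * rho n.+1] that the lower one requires at level [n.+1]. *)
Definition scale_level n r := 6 * rho n.+1 < r <= 6 * rho n.

Lemma scale_level_exists r : 0 < r -> r <= 6 * rho0 -> exists n, scale_level n r.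
Proof.
move=> r0 rrho.
have [k0 k0r] : exists k, (6 * rho0) * lam ^+ k < r.
  by apply: exists_expr_lt => //; [rewrite (ltW lam_gt0)|rewrite mulr_gt0].
have [|k kr kmin] := @ex_minnP (fun k => (6 * rho0) * lam ^+ k < r); first by exists k0.
(* The least such exponent is positive because [r <= 6 * rho0]; the level of [r] is its
   predecessor. *)
case: k kr kmin => [|n] nr nmin; first by move: nr; rewrite expr0 mulr1; lra.
exists n; rewrite /scale_level mulrA nr /= leNgt mulrA.
by apply/negP => /nmin; rewrite ltnn.
Qed.

Lemma scale_level_mono n m r s : scale_level n r -> scale_level m s -> r <= s ->
  (m <= n)%N.
Proof.
move=> /andP[rn _] /andP[_ sm] rs; rewrite leqNgt; apply/negP => nm.
have : rho m <= rho n.+1.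
  by rewrite ler_wpM2l ?(ltW rho0_gt0)// ler_wiXn2l// ltW.
lra.
Qed.

(** The product of [lam ^+ (n - m)] and [s / r] lies between [lam] and [lam^-1], each radius being
    known up to a factor [lam]; this is raised to the power [a]. *)
Lemma scale_level_ratio a n m r s : 0 <= a -> (m <= n)%N ->
  scale_level n r -> scale_level m s ->
  lam `^ a <= (lam `^ a) ^+ (n - m) * (s / r) `^ a <= (lam `^ a)^-1.
Proof.
move=> a0 mn /andP[r1 r2] /andP[s1 s2].
have rho_pos k : 0 < rho k by rewrite mulr_gt0 ?exprn_gt0.
have r0 : 0 < r by apply: lt_trans r1; rewrite mulr_gt0.
have s0 : 0 < s by apply: lt_trans s1; rewrite mulr_gt0.
have e0 : 0 < lam ^+ (n - m) by rewrite exprn_gt0.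
have eE : lam ^+ (n - m) * rho m = rho n.
  by rewrite mulrCA -exprD subnK.
have rS k : rho k.+1 = lam * rho k by rewrite exprS mulrCA.
have -> : (lam `^ a) ^+ (n - m) = (lam ^+ (n - m)) `^ a.
  by rewrite -powR_mulrn ?powR_ge0// -powRrM mulrC powRrM powR_mulrn// ltW.
have -> : (lam `^ a)^-1 = (lam^-1) `^ a.
  by rewrite -powR_inv1 ?powR_ge0// -powRrM mulrC powRrM powR_inv1// ltW.
rewrite -powRM ?(ltW e0) ?(ltW (divr_gt0 s0 r0))//.
apply/andP; split; apply: ge0_ler_powR => //.
- by rewrite nnegrE ltW.
- by rewrite nnegrE mulr_ge0 ?ltW// divr_gt0.
- rewrite mulrA ler_pdivlMr//.
  apply: (@le_trans _ _ (6 * rho n.+1)).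
    have -> : 6 * rho n.+1 = lam * (6 * rho n) by rewrite rS; ring.
    by rewrite ler_pM2l.
  have -> : 6 * rho n.+1 = lam ^+ (n - m) * (6 * rho m.+1).
    by rewrite !rS -eE; ring.
  by rewrite ler_pM2l// ltW.
- by rewrite nnegrE mulr_ge0 ?ltW// divr_gt0.
- by rewrite nnegrE ltW// invr_gt0.
- rewrite mulrA ler_pdivrMr// ler_pdivlMl//.
  apply: (@le_trans _ _ (6 * rho n.+1)); last exact: ltW.
  have -> : 6 * rho n.+1 = lam * (lam ^+ (n - m) * (6 * rho m)).
    by rewrite rS -eE; ring.
  by rewrite !ler_pM2l.
Qed.

Variables (p K : R) (F : R -> R) (M : nat -> R).
Hypothesis p_gt0 : 0 < p.
Hypothesis K_gt0 : 0 < K.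

(* [M k] stands for the mass of the cell of level [k] at the centre of the balls
   whose masses are given by [F]. *)
Lemma ratio_le_of_mass a n m r s : 0 <= a -> (m <= n)%N ->
  scale_level n r -> scale_level m s -> 0 < M n ->
  p * M n <= F r -> F s <= K * M m -> (lam `^ a) ^+ (n - m) * M m <= M n ->
  F s <= K / (p * lam `^ a) * (s / r) `^ a * F r.
Proof.
move=> a0 mn rn sm Mn0 Fr Fs MM; set b := lam `^ a in MM *.
have b0 : 0 < b by exact: powR_gt0.
have /andP[+ _] := scale_level_ratio a0 mn rn sm; rewrite -/b.
set T := (s / r) `^ a => bT; have T0 : 0 <= T by exact: powR_ge0.
have e0 : 0 < b ^+ (n - m) by rewrite exprn_gt0.
apply: (le_trans Fs).
have -> : K / (p * b) * T * F r = K * ((p * b)^-1 * (T * F r)) by ring.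
rewrite ler_pM2l// ler_pdivlMl ?mulr_gt0//.
have : b * M m <= T * M n.
  rewrite -(ler_pM2l e0) [X in X <= _]mulrCA.
  apply: (@le_trans _ _ (b * M n)); first by rewrite ler_pM2l.
  by rewrite mulrA ler_pM2r.
move=> bM; apply: (@le_trans _ _ (p * (T * M n))); first by rewrite -mulrA ler_pM2l.
by rewrite mulrCA ler_wpM2l.
Qed.

(** Pass from [F r] to [M n], [M m] and [F s], trading powers of [lam] for powers of [s / r]. It
    serves every point with exponent [d] and the light ray with exponent [D]; [ratio_le_of_mass]
    serves every point with [D] and the heavy ray with [d]. *)
Lemma ratio_ge_of_mass a n m r s : 0 <= a -> (m <= n)%N ->
  scale_level n r -> scale_level m s -> 0 < M m ->
  F r <= K * M n -> p * M m <= F s -> M n <= (lam `^ a) ^+ (n - m) * M m ->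
  p * lam `^ a / K * (s / r) `^ a * F r <= F s.
Proof.
move=> a0 mn rn sm Mm0 Fr Fs MM; set b := lam `^ a in MM *.
have b0 : 0 < b by exact: powR_gt0.
have /andP[_] := scale_level_ratio a0 mn rn sm; rewrite -/b.
set T := (s / r) `^ a => bT; have T0 : 0 <= T by exact: powR_ge0.
apply: le_trans Fs.
have -> : p * b / K * T * F r = p * (b * T * (K^-1 * F r)) by ring.
rewrite ler_pM2l//.
apply: (@le_trans _ _ (b * T * M n)).
  by rewrite ler_wpM2l ?mulr_ge0 ?(ltW b0)// ler_pdivrMl.
apply: (@le_trans _ _ (b * T * (b ^+ (n - m) * M m))).
  by rewrite ler_wpM2l ?mulr_ge0 ?(ltW b0).
rewrite mulrA -[leRHS]mul1r ler_pM2r//.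
by rewrite -mulrA [T * _]mulrC -ler_pdivlMl// mulr1.
Qed.

End Scales.

(** * Rays of constant proportion, and the support of the limit measure *)

Section MeasureOfTree.
Context (R : realType) (E : set R^o) (rho0 lam p q : R).
Context (rho0_gt0 : 0 < rho0) (lam_gt0 : 0 < lam) (lam_small : lam <= 64^-1).
Context (p_gt0 : 0 < p) (pq : p <= q) (q_small : q <= 2^-1).
Context (compact_E : compact E).
Variable t : net_tree E rho0 lam p q.

Notation rho k := (rho0 * lam ^+ k).

(** Pass repeatedly to a child of proportion [c]. The ray converges by [geometric_cvg], and its
    limit is in [E] because [E] is closed. *)
Lemma ray_exists (c : R) (y0 : R) : 0 < c -> y0 \in net t 0 ->
  (forall k x, x \in net t k ->
    exists2 y, y \in net t k.+1 & parent t k y = x /\ weight t k y = c) ->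
  exists x z, [/\ E x, forall k, z k \in net t k,
    forall k, `|z k - x| <= 2 * rho k,
    forall k, parent t k (z k.+1) = z k & forall k, mass t k (z k) = c ^+ k].
Proof.
move=> c0 y0n ch.
have /choice[f fP] : forall kx : nat * R, exists y, kx.2 \in net t kx.1 ->
    [/\ y \in net t kx.1.+1, parent t kx.1 y = kx.2 & weight t kx.1 y = c].
  case=> k x /=; case: (boolP (x \in net t k)) => [/ch[y yk [yx yc]]|_].
    by exists y.
  (* A default value off the net, never met along the ray. *)
  by exists 0.
pose fix z k := if k is k'.+1 then f (k', z k') else y0.
have zn k : z k \in net t k by elim: k => [//|k IH] /=; case: (fP (k, z k) IH).
have zpar k : parent t k (z k.+1) = z k by case: (fP (k, z k) (zn k)).
have zw k : weight t k (z k.+1) = c by case: (fP (k, z k) (zn k)).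
have [x [_ xz]] : exists l, (fun k => z k - 2 * rho k) @ \oo --> l /\
    forall k, `|l - z k| <= 2 * rho k.
  apply: (@geometric_cvg _ z (fun k => rho k)) => k.
  - have := rho_gt0 rho0_gt0 lam_gt0 k; have := rhoS_le rho0_gt0 lam_gt0 lam_small k; lra.
  - exact/ltW/rho_gt0.
  - by rewrite -[in X in _ - X](zpar k); exact/ltW/parent_dist.
exists x, z; split=> //.
- apply: compact_adherent => // e e0.
  have [|||k ke] := @exists_expr_lt _ lam (2 * rho0) e => //.
  + by rewrite (ltW lam_gt0) /=; move: lam_small; lra.
  + by rewrite mulr_gt0.
  exists (z k); first exact: net_sub (zn k).
  by apply: le_lt_trans ke; rewrite -mulrA.
- by move=> k; rewrite distrC.
- elim=> [//|k IH]; rewrite exprSr -IH -[in RHS](zpar k) -[in RHS](zw k).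
  by rewrite [LHS]/=.
Qed.

(** The complement of [E] is open and null, whereas every ball about a point of [E] has at least the
    mass of some cell. The child [z'] enters because the lower ball estimate applies one level
    further down, at the cost of a factor [p]. *)
Lemma net_tree_measure : E !=set0 ->
  exists (mu : {finite_measure set (measurableTypeR R) -> \bar R}) (F : R -> R -> R) (K : R),
  [/\ msupport (mu : set R^o -> \bar R) = E, 0 < K,
    forall x r, E x -> 0 < r -> mu (ball (x : R^o) r) = (F x r)%:E,
    forall x r, E x -> 0 < r -> 0 < F x r &
    forall n z z' x r, z \in net t n -> z' \in net t n.+1 -> parent t n z' = z ->
      `|z - x| <= 2 * rho n -> `|z' - x| <= 2 * rho n.+1 ->
      scale_level rho0 lam n r ->
      p * mass t n z <= F x r <= K * mass t n z].
Proof.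
move=> [x0 Ex0].
have [mu [muE lower upper]] :=
  tree_measure_exists rho0_gt0 lam_gt0 lam_small p_gt0 pq q_small compact_E t.
have muF x r : mu (ball (x : R^o) r) = (fine (mu (ball (x : R^o) r)))%:E.
  by rewrite fineK// fin_num_measure//; exact: measurable_ball.
have mu_gt0 x r : E x -> 0 < r -> (0 < mu (ball (x : R^o) r))%E.
  move=> Ex r0.
  have [|||k kr] := @exists_expr_lt _ lam (4 * rho0) r => //.
  + by rewrite (ltW lam_gt0) /=; move: lam_small; lra.
  + by rewrite mulr_gt0.
  have [y yk xy] := net_cover t k Ex.
  apply: (@lt_le_trans _ _ (mass t k y)%:E).
    by rewrite lte_fin; apply: mass_gt0.
  apply: (lower k) => //; last by rewrite mulrA.
  rewrite distrC; have := rho_gt0 rho0_gt0 lam_gt0 k; move: xy; lra.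
exists mu, (fun x r => fine (mu (ball (x : R^o) r))), (17 / p); split.
- apply/seteqP; split=> x.
  + move=> xsupp; apply: contrapT => nEx.
    have oE : open (~` E : set R^o).
      by rewrite openC; apply: compact_closed => //; exact: Rhausdorff.
    by have := xsupp _ oE nEx; rewrite muE ltxx.
  + move=> Ex U oU Ux; have /nbhs_ballP[r /= r0 rU] : nbhs (x : R^o) U.
      exact: open_nbhs_nbhs.
    apply: (lt_le_trans (mu_gt0 _ _ Ex r0)); apply: le_measure => //; rewrite inE.
      exact: measurable_ball.
    exact: open_measurable.
- by rewrite divr_gt0.
- by move=> x r _ _.
- by move=> x r Ex r0; rewrite -lte_fin -muF; exact: mu_gt0.
- move=> n z z' x r zn zn' z'z zx zx' /andP[r1 r2]; apply/andP; split.
  + rewrite -lee_fin -muF; apply: (@le_trans _ _ (mass t n.+1 z')%:E).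
      by rewrite lee_fin; have /andP[+ _] := mass_parent p_gt0 zn'; rewrite z'z.
    apply: (lower n.+1) => //; have := rho_gt0 rho0_gt0 lam_gt0 n.+1; move: r1; lra.
  + by rewrite -lee_fin -muF; exact: upper.
Qed.

End MeasureOfTree.

Lemma net_tree_assouad (R : realType) (E : set R^o) (rho0 lam d D : R)
    (t : net_tree E rho0 lam (lam `^ D) (lam `^ d)) :
  compact E -> E !=set0 -> 0 < rho0 -> 0 < lam -> lam <= 64^-1 ->
  0 < d -> d < D -> lam `^ d <= 2^-1 ->
  exists mu : {finite_measure set (measurableTypeR R) -> \bar R},
    [/\ msupport (mu : set R^o -> \bar R) = E,
        lower_assouad_measure (mu : set R^o -> \bar R) = d%:E &
        upper_assouad_measure (mu : set R^o -> \bar R) = D%:E].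
Proof.
move=> cE E0 rho0_gt0 lam_gt0 lam_small d0 dD q_small.
have lam1 : lam < 1 by lra.
set p := lam `^ D in t *; set q := lam `^ d in t q_small *.
have p_gt0 : 0 < p by exact: powR_gt0.
have q_gt0 : 0 < q by exact: powR_gt0.
have D0 : 0 <= D by lra.
have pq : p <= q.
  by apply: ger_powR; [rewrite lam_gt0 ltW|exact: ltW].
have [mu [F [K [suppE K0 muE F0 FK]]]] :=
  net_tree_measure rho0_gt0 lam_gt0 lam_small p_gt0 pq q_small cE t E0.
have [x0 Ex0] := E0.
have [y0 y0n _] := net_cover t 0 Ex0.
(* The light ray will attain the exponent [D], the heavy ray below it the exponent [d]. *)
have [xl [zl [Exl zln zlx zlpar zlm]]] :=
  ray_exists rho0_gt0 lam_gt0 lam_small cE p_gt0 y0n (light_child (n := t)).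
have [xh [zh [Exh zhn zhx zhpar zhm]]] :=
  ray_exists rho0_gt0 lam_gt0 lam_small cE q_gt0 y0n (heavy_child (n := t)).
have Fl n r : scale_level rho0 lam n r ->
    p * mass t n (zl n) <= F xl r <= K * mass t n (zl n).
  by apply: (FK n _ (zl n.+1)).
have Fh n r : scale_level rho0 lam n r ->
    p * mass t n (zh n) <= F xh r <= K * mass t n (zh n).
  by apply: (FK n _ (zh n.+1)).
have lev r s : 0 < r -> r <= s -> s <= 6 * rho0 -> exists m n,
    [/\ (m <= n)%N, scale_level rho0 lam m s & scale_level rho0 lam n r].
  move=> r0 rs s0.
  have [n nr] := scale_level_exists rho0_gt0 lam_gt0 lam1 r0 (le_trans rs s0).
  have [m ms] := scale_level_exists rho0_gt0 lam_gt0 lam1 (lt_le_trans r0 rs) s0.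
  by exists m, n; split=> //; exact: (scale_level_mono rho0_gt0 lam_gt0 lam1 nr ms rs).
(* [M k] is the mass of the ancestor at level [k] of a net point close to [x]. That point is taken
   at level [n.+1], so that the ancestor at level [n] still has a child in the chain, as [FK]
   requires. *)
have near x r s : E x -> 0 < r -> r <= s -> s <= 6 * rho0 -> exists m n (M : nat -> R),
    [/\ (m <= n)%N, scale_level rho0 lam m s & scale_level rho0 lam n r] /\
    [/\ 0 < M m, 0 < M n, p * M m <= F x s <= K * M m,
    p * M n <= F x r <= K * M n &
    p ^+ (n - m) * M m <= M n <= q ^+ (n - m) * M m].
  move=> Ex r0 rs s0; have [m [n [mn ms nr]]] := lev _ _ r0 rs s0.
  have [y yN xy] := net_cover t n.+1 Ex.
  pose z := branch t n.+1 y; exists m, n, (fun k => mass t k (z k)); split=> //.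
  have zn k : (k <= n.+1)%N -> z k \in net t k by move=> kn; exact: branch_net.
  have zx k : (k <= n.+1)%N -> `|z k - x| <= 2 * (rho0 * lam ^+ k).
    move=> kn; have := branch_dist rho0_gt0 lam_gt0 lam_small kn yN.
    have := rho_gt0 rho0_gt0 lam_gt0 n.+1; move: xy.
    by rewrite /z ltr_norml !ler_norml; lra.
  have zpar k : (k <= n)%N -> parent t k (z k.+1) = z k.
    by move=> kn; exact: branch_parent.
  have m_gt0 k : (k <= n)%N -> 0 < mass t k (z k).
    by move=> kn; apply: mass_gt0 => //; apply: zn; exact: leqW.
  have Fz k u : (k <= n)%N -> scale_level rho0 lam k u ->
      p * mass t k (z k) <= F x u <= K * mass t k (z k).
    move=> kn; apply: FK (zn k.+1 kn) (zpar k kn) _ (zx k.+1 kn).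
      exact: zn (leqW kn).
    exact: zx (leqW kn).
  split; [exact: m_gt0|exact: m_gt0|exact: Fz|exact: Fz|].
  have zE k : (k <= n)%N -> z k = branch t n (z n) k.
    by move=> kn; rewrite /z /= kn leqnn branch_last.
  by rewrite (zE m)//; apply: mass_branch => //; exact: zn.
have s0_gt0 : 0 < 6 * rho0 by rewrite mulr_gt0.
have expC c k m : (m <= k)%N -> c ^+ (k - m) * c ^+ m = c ^+ k :> R.
  by move=> mk; rewrite -exprD subnK.
exists mu; split=> //.
(* [6 * rho0] is the largest radius that has a scale level; [c] and [C] are the constants of
   [ratio_ge_of_mass] and [ratio_le_of_mass] for the exponent [d]. *)
- apply: (lower_assouad_measure_eq suppE muE F0 (s0 := 6 * rho0)
      (c := p * q / K) (C := K / (p * q)) (x0 := xh)) => //.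
  + by rewrite divr_gt0 ?mulr_gt0.
  + by rewrite divr_gt0 ?mulr_gt0.
  + move=> x r s Ex r0 rs s0.
    have [m [n [M [[mn ms nr] [Mm _ /andP[Fs _] /andP[_ Fr] /andP[_ MM]]]]]] :=
      near _ _ _ Ex r0 rs s0.
    exact: (ratio_ge_of_mass rho0_gt0 lam_gt0 p_gt0 K0 (ltW d0) mn nr ms Mm Fr Fs MM).
  + move=> r s r0 rs s0; have [m [n [mn ms nr]]] := lev _ _ r0 rs s0.
    have /andP[Fr _] := Fh _ _ nr; have /andP[_ Fs] := Fh _ _ ms.
    apply: (ratio_le_of_mass (M := fun k => mass t k (zh k)) rho0_gt0 lam_gt0 p_gt0 K0
      (ltW d0) mn nr ms _ Fr Fs).
      by rewrite /= zhm exprn_gt0.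
    by rewrite /= !zhm expC.
- apply: (upper_assouad_measure_eq suppE muE F0 (s0 := 6 * rho0)
      (c := p * p / K) (C := K / (p * p)) (x0 := xl)) => //.
  + by rewrite divr_gt0 ?mulr_gt0.
  + by rewrite divr_gt0 ?mulr_gt0.
  + move=> x r s Ex r0 rs s0.
    have [m [n [M [[mn ms nr] [_ Mn /andP[_ Fs] /andP[Fr _] /andP[MM _]]]]]] :=
      near _ _ _ Ex r0 rs s0.
    exact: (ratio_le_of_mass rho0_gt0 lam_gt0 p_gt0 K0 D0 mn nr ms Mn Fr Fs MM).
  + move=> r s r0 rs s0; have [m [n [mn ms nr]]] := lev _ _ r0 rs s0.
    have /andP[_ Fr] := Fl _ _ nr; have /andP[Fs _] := Fl _ _ ms.
    apply: (ratio_ge_of_mass (M := fun k => mass t k (zl k)) rho0_gt0 lam_gt0 p_gt0 K0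
      D0 mn nr ms _ Fr Fs).
      by rewrite /= zlm exprn_gt0.
    by rewrite /= !zlm expC.
Qed.

(** * Construction of the tree *)

(** [cU] bounds the number of children of a point from above and [cL] the number of its core
    children from below, which is what [weights_exist] asks for. *)
Lemma net_tree_exists (R : realType) (E : set R^o) (rho0 lam p q cU cL : R) :
  compact E -> 0 < rho0 -> 0 < lam -> lam <= 64^-1 -> 0 < p -> 0 < q -> q <= 2^-1 ->
  cU * p <= 2^-1 -> 2 <= cL * q ->
  (forall k x, E x -> (covering_number (rho0 * lam ^+ k.+1 / 2)
    (ball x (2 * (rho0 * lam ^+ k)) `&` E) <= cU%:E)%E) ->
  (forall k x, E x -> (cL%:E <= covering_number (2 * (rho0 * lam ^+ k.+1))
    (ball x (rho0 * lam ^+ k / 8) `&` E))%E) ->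
  inhabited (net_tree E rho0 lam p q).
Proof.
move=> cE rho0_gt0 lam_gt0 lam_small p_gt0 q_gt0 q_small cUp cLq covU covL.
have r_gt0 k := rho_gt0 rho0_gt0 lam_gt0 k.
have /choice[N NP] : forall k, exists s : seq R, [/\ uniq s,
    forall y, y \in s -> E y, separated (rho0 * lam ^+ k) s &
    forall x, E x -> exists2 y, y \in s & `|x - y| < rho0 * lam ^+ k].
  by move=> k; exact: net_exists.
have Nu k : uniq (N k) by case: (NP k).
have NE k y : y \in N k -> E y by case: (NP k) => _ + _ _; exact.
have Nsep k : separated (rho0 * lam ^+ k) (N k) by case: (NP k).
have Ncov k x : E x -> exists2 y, y \in N k & `|x - y| < rho0 * lam ^+ k.
  by case: (NP k) => _ _ _; exact.
(* A net point closer than half the scale becomes the parent, and separation makes it unique; if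
   there is none, any net point within the scale is taken. Off [E] the value 0 is a default. *)
have /choice[par parP] : forall ky : nat * R, exists x, E ky.2 ->
    [/\ x \in N ky.1, `|ky.2 - x| < rho0 * lam ^+ ky.1 &
    forall x', x' \in N ky.1 -> `|ky.2 - x'| < rho0 * lam ^+ ky.1 / 2 -> x = x'].
  case=> k y /=; have [Ey|nEy] := pselect (E y); last by exists 0.
  have [[x xk xy]|nx] :=
      pselect (exists2 x, x \in N k & `|y - x| < rho0 * lam ^+ k / 2).
    exists x => _; split=> //; first by have := r_gt0 k; move: xy; lra.
    move=> x' x'k x'y; apply/eqP; apply: contraT => /(Nsep k _ _ xk x'k).
    by move: xy x'y; rewrite leNgt !ltr_norml => xy x'y /negP[]; lra.
  have [x xk xy] := Ncov k _ Ey.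
  by exists x => _; split=> // x' x'k x'y; case: nx; exists x'.
pose ch k x := [seq y <- N k.+1 | par (k, y) == x].
have rS k : rho0 * lam ^+ k.+1 <= rho0 * lam ^+ k / 64 by exact: rhoS_le.
pose core k (x y : R) := `|y - x| <= rho0 * lam ^+ k / 4.
have parE k y : y \in N k.+1 -> [/\ par (k, y) \in N k,
    `|y - par (k, y)| < rho0 * lam ^+ k &
    forall x, x \in N k -> `|y - x| < rho0 * lam ^+ k / 2 -> par (k, y) = x].
  by move=> yk; exact: (parP (k, y) (NE _ _ yk)).
have chU k x : x \in N k -> (size (ch k x))%:R <= cU.
  move=> xk; rewrite -lee_fin; apply: le_trans (covU k _ (NE _ _ xk)).
  apply: le_covering_number; first by rewrite filter_uniq.
  - move=> y; rewrite mem_filter => /andP[/eqP yx yk].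
    have [_ + _] := parE _ _ yk; rewrite yx => xy; split; last exact: NE yk.
    by rewrite -ball_normE /= distrC; have := r_gt0 k; move: xy; lra.
  - move=> y z; rewrite !mem_filter => /andP[_ yk] /andP[_ zk] yz.
    by have := Nsep _ _ _ yk zk yz; have := r_gt0 k.+1; lra.
(* Net points that cover the ball of radius [rho0 * lam ^+ k / 8] about [x] are within
   [1/8 + 1/64 < 1/4] of the scale from [x]: they are core, and being closer than half the scale
   they are children of [x]. *)
have chL k x : x \in N k -> cL <= (count (core k x) (ch k x))%:R.
  move=> xk; rewrite -lee_fin; apply: (le_trans (covL k _ (NE _ _ xk))).
  rewrite -size_filter; apply: covering_number_le => e [].
  rewrite -ball_normE /= => xe /(Ncov k.+1)[y yk ey].
  have yx : core k x y.
    by rewrite /core; have := rS k; move: xe ey; rewrite !ltr_norml ler_norml; lra.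
  exists y; last by move: ey; lra.
  have [_ _ /(_ x xk) yx'] := parE _ _ yk.
  rewrite !mem_filter yx yk andbT /=; apply/eqP/yx'.
  by move: yx; rewrite /core; have := r_gt0 k; lra.
have /choice[w wP] : forall kx : nat * R, exists w : R -> R, kx.2 \in N kx.1 ->
    [/\ \sum_(y <- ch kx.1 kx.2) w y = 1,
    forall y, y \in ch kx.1 kx.2 -> p <= w y <= q,
    forall y, y \in ch kx.1 kx.2 -> ~~ core kx.1 kx.2 y -> w y = p,
    exists2 y, y \in ch kx.1 kx.2 & w y = q &
    exists2 y, y \in ch kx.1 kx.2 & w y = p].
  case=> k x /=; case: (boolP (x \in N k)) => xk; last by exists (fun=> 0).
  have uch : uniq (ch k x) by rewrite filter_uniq.
  have sp : (size (ch k x))%:R * p <= 2^-1.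
    by apply: le_trans cUp; rewrite ler_pM2r// chU.
  have cq : 2 <= (count (core k x) (ch k x))%:R * q.
    by apply: (le_trans cLq); rewrite ler_pM2r// chL.
  by have [w wP] := weights_exist uch p_gt0 q_small sp cq; exists w.
constructor; apply: (@NetTree _ _ _ _ _ _ N (fun k y => par (k, y))
  (fun k y => w (k, par (k, y)) y)) => //.
- by move=> k y /parE[].
- by move=> k y /parE[].
- by move=> k x y /parE[_ _]; exact.
- move=> k x xk; case: (wP (k, x) xk) => /= + _ _ _ _; move=> <-.
  by apply: eq_big_seq => y; rewrite mem_filter => /andP[/eqP -> _].
- move=> k y yk; have [pk _ _] := parE _ _ yk.
  by case: (wP (k, par (k, y)) pk) => /= _ + _ _ _; apply; rewrite mem_filter eqxx.
- move=> k y yk; have [pk _ _] := parE _ _ yk => yp.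
  case: (wP (k, par (k, y)) pk) => /= _ _ + _ _; apply; rewrite ?mem_filter ?eqxx//.
  by rewrite /core -ltNge.
- move=> k x xk; case: (wP (k, x) xk) => /= _ _ _ [y + wy] _.
  by rewrite mem_filter => /andP[/eqP yx yk]; exists y; rewrite ?yx.
- move=> k x xk; case: (wP (k, x) xk) => /= _ _ _ _ [y + wy].
  by rewrite mem_filter => /andP[/eqP yx yk]; exists y; rewrite ?yx.
Qed.

Lemma powR_le_near0 (R : realType) (e c : R) : 0 < e -> 0 < c ->
  exists2 l0, 0 < l0 & forall l, 0 < l -> l <= l0 -> l `^ e <= c.
Proof.
move=> e0 c0; exists (c `^ e^-1); first exact: powR_gt0.
move=> l l_gt0 ll; apply: (@le_trans _ _ ((c `^ e^-1) `^ e)).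
  by apply: ge0_ler_powR; rewrite ?nnegrE ?powR_ge0// ltW.
by rewrite -powRrM mulVf ?gt_eqF// powRr1// ltW.
Qed.

(* R^o is the line with its metric structure, mdist x y = `|y - x|. *)
Theorem theorem4p1 (R : realType) (E : set R^o) (d D : R) :
  compact E ->
  0 < d ->
  (d%:E < lower_assouad E)%E ->
  (lower_assouad E <= upper_assouad E)%E ->
  (upper_assouad E < D%:E)%E ->
  exists mu : {finite_measure set (measurableTypeR R) -> \bar R},
    [/\ msupport (mu : set R^o -> \bar R) = E,
        lower_assouad_measure (mu : set R^o -> \bar R) = d%:E &
        upper_assouad_measure (mu : set R^o -> \bar R) = D%:E].
Proof.
move=> cE d0 dL LU UD.
have dD : d < D by rewrite -lte_fin (lt_trans dL)// (le_lt_trans LU).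
(* For empty [E] the infimum over its points is [+oo], so [D] would be admissible for the lower
   dimension, which is less than [D]. *)
have E0 : E !=set0.
  apply/set0P/eqP => E0; have := le_lt_trans LU UD; rewrite ltNge => /negP[].
  apply: ereal_sup_ubound; exists D => //; exists 1, 1; split=> // r s _ _ _.
  by apply: le_ereal_inf_tmp => y [x]; rewrite E0.
move: dL => /ereal_sup_gt[_ [a [A1 [A2 [A1_gt0 A2_gt0 aP]]] <-]]; rewrite lte_fin => da.
move: UD => /ereal_inf_lt[_ [b [B1 [B2 [B1_gt0 B2_gt0 bP]]] <-]]; rewrite lte_fin => bD.
(* The gaps [d < a] and [b < D] are exploited by taking [lam] small: [l1] ensures at least [2 / q]
   core children, [l2] at most [1 / (2 * p)] children, and [l3] that [q <= 2^-1]. *)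
have [l1 l1_gt0 l1P] : exists2 l0, 0 < l0 & forall l, 0 < l -> l <= l0 ->
    l `^ (a - d) <= A2 * 16^-1 `^ a / 2.
  by apply: powR_le_near0; rewrite ?subr_gt0// !mulr_gt0// powR_gt0.
have [l2 l2_gt0 l2P] : exists2 l0, 0 < l0 & forall l, 0 < l -> l <= l0 ->
    l `^ (D - b) <= (B2 * 4 `^ b)^-1 / 2.
  by apply: powR_le_near0; rewrite ?subr_gt0// divr_gt0// invr_gt0 mulr_gt0// powR_gt0.
have [l3 l3_gt0 l3P] : exists2 l0, 0 < l0 & forall l, 0 < l -> l <= l0 ->
    l `^ d <= 2^-1.
  exact: powR_le_near0.
pose lam := Num.min (Num.min l1 l2) (Num.min l3 64^-1).
have lam_gt0 : 0 < lam by rewrite !lt_min l1_gt0 l2_gt0 l3_gt0 /=; lra.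
have lam_l1 : lam <= l1 by rewrite !ge_min lexx.
have lam_l2 : lam <= l2 by rewrite !ge_min lexx orbT.
have lam_l3 : lam <= l3 by rewrite !ge_min lexx !orbT.
have lam_small : lam <= 64^-1 by rewrite !ge_min lexx !orbT.
(* The largest radius to which the covering bounds are applied is [2 * rho0], which is below [A1]
   and [B1]. *)
pose rho0 := Num.min A1 B1 / 4.
have min_gt0 : 0 < Num.min A1 B1 by rewrite lt_min A1_gt0.
have minA : Num.min A1 B1 <= A1 by rewrite ge_min lexx.
have minB : Num.min A1 B1 <= B1 by rewrite ge_min lexx orbT.
have rho0_gt0 : 0 < rho0 by rewrite divr_gt0.
have r_gt0 k : 0 < rho0 * lam ^+ k by exact: rho_gt0.
have r_le k : rho0 * lam ^+ k <= rho0.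
  by rewrite ler_piMr ?(ltW rho0_gt0)// exprn_ile1 ?(ltW lam_gt0)//; lra.
have rS k : rho0 * lam ^+ k.+1 <= rho0 * lam ^+ k / 64 by exact: rhoS_le.
have rhoE k : rho0 * lam ^+ k.+1 = lam * (rho0 * lam ^+ k) by exact: rhoS.
(* With [rho k] for [rho0 * lam ^+ k], the base [4 / lam] is the ratio of [2 * rho k] to
   [rho k.+1 / 2], and [16^-1 / lam] that of [rho k / 8] to [2 * rho k.+1]. *)
pose cU := B2 * (4 / lam) `^ b.
pose cL := A2 * (16^-1 / lam) `^ a.
have lam_pow c e : 0 < c -> (c / lam) `^ e = c `^ e / lam `^ e.
  move=> c0; rewrite powRM ?(ltW c0) ?invr_ge0 ?(ltW lam_gt0)//.
  by rewrite -[lam^-1]powR_inv1 ?ltW// -powRrM mulN1r powRN.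
have [t] : inhabited (net_tree E rho0 lam (lam `^ D) (lam `^ d)).
  apply: (@net_tree_exists _ _ _ _ _ _ cU cL) => //.
  - exact: powR_gt0.
  - exact: powR_gt0.
  - exact: l3P.
  - rewrite /cU lam_pow//.
    have -> : B2 * (4 `^ b / lam `^ b) * lam `^ D = B2 * 4 `^ b * lam `^ (D - b).
      by rewrite powRB ?(gt_eqF lam_gt0) ?implybT//; ring.
    by rewrite -ler_pdivlMl ?mulr_gt0 ?powR_gt0//; exact: l2P.
  - rewrite /cL lam_pow ?invr_gt0//.
    have lam_ad : lam `^ (a - d) * (2 * lam `^ d) = 2 * lam `^ a.
      by rewrite mulrCA -powRD ?(gt_eqF lam_gt0) ?implybT// subrK.
    have -> : A2 * (16^-1 `^ a / lam `^ a) * lam `^ d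
        = A2 * 16^-1 `^ a * lam `^ d / lam `^ a by ring.
    rewrite ler_pdivlMr ?powR_gt0// -lam_ad mulrA ler_pM2r ?powR_gt0//.
    by rewrite -ler_pdivlMr//; exact: l1P.
  - move=> k x Ex.
    have := bP (rho0 * lam ^+ k.+1 / 2) (2 * (rho0 * lam ^+ k)).
    have -> : 2 * (rho0 * lam ^+ k) / (rho0 * lam ^+ k.+1 / 2) = 4 / lam.
      by rewrite rhoE; field; rewrite !gt_eqF ?exprn_gt0.
    have := r_gt0 k; have := r_gt0 k.+1; have := rS k; have := r_le k.
    move=> h1 h2 h3 h4 h.
    apply: (le_trans _ (h _ _ _)).
    + by apply: ereal_sup_ubound; exists x.
    + lra.
    + lra.
    + by move: h1 minB; rewrite {2}/rho0; lra.
  - move=> k x Ex.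
    have := aP (2 * (rho0 * lam ^+ k.+1)) (rho0 * lam ^+ k / 8).
    have -> : rho0 * lam ^+ k / 8 / (2 * (rho0 * lam ^+ k.+1)) = 16^-1 / lam.
      by rewrite rhoE; field; rewrite !gt_eqF ?exprn_gt0.
    have := r_gt0 k; have := r_gt0 k.+1; have := rS k; have := r_le k.
    move=> h1 h2 h3 h4 h.
    apply: (le_trans (h _ _ _)).
    + lra.
    + lra.
    + by move: h1 minA; rewrite {2}/rho0; lra.
    + by apply: ereal_inf_lbound; exists x.
by apply: (net_tree_assouad t) => //; exact: l3P.
Qed.
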